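(* The typed $\pi$-calculus $\pi$ terminates: if $\Gamma\vdash^{\pi}D$, then there is no infinite reduction sequence $D\to D_1\to D_2\to\cdots$.
   Context: Processes up to $\alpha$-renaming of bound names; $[z^+/y^+]D$ is capture-avoiding substitution of names. Syntax (braces $\{\ldots\}$ mark optional parts): declarations $D::=\nu x\,D\mid\nu x\,(x(y_1,\ldots,y_n).D\mid D)\mid\nu x\,(!x(y_1,\ldots,y_n).D\mid D)\mid M$; terms $M::=\overline{x}(y_1,\ldots,y_n)\mid(M\mid M)$ ($n\ge1$); evaluation contexts $E::=[\,]\mid E[\nu x\,[\,]]\mid E[\nu x\,(\{!\}x(y^+).D\mid[\,])]\mid E[[\,]\mid M]\mid E[M\mid[\,]]$; types $A::=\langle1\rangle\mid\langle A_1,\ldots,A_n\rangle$. Convention: when a declaration is placed in a term position (e.g. in a parallel composition or a context hole), its $\nu$-binders and definitions are moved outward in front (renamed apart). Structural congruence $\equiv$: least equivalence closed under $\alpha$-renaming and the operators with $\nu x_1(\{\{!\}x_1(y_1^+).D_1\mid\}\nu x_2(\{\{!\}x_2(y_2^+).D_2\mid\}D))\equiv\nu x_2(\{\{!\}x_2(y_2^+).D_2\mid\}\nu x_1(\{\{!\}x_1(y_1^+).D_1\mid\}D))$ if $x_1\notin FV(\lambda y_1^+.D_1)$ and $x_2\notin FV(\lambda y_2^+.D_2)$, and $\nu x(\{\{!\}x(y^+).D'\mid\}D)\equiv D$ if $x\notin FV(D)$. Reduction: least relation containing $E[\nu x\,(!x(y^+).D\mid E'[\overline{x}z^+])]\to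 E[\nu x\,(!x(y^+).D\mid E'[[z^+/y^+]D])]$ and $E[\nu x\,(x(y^+).D\mid E'[\overline{x}z^+])]\to E[\nu x\,(E'[[z^+/y^+]D])]$ (with $y^+,z^+$ of equal length), closed under $\equiv$. Typing ($\Gamma$ a finite map from names to types): $\Gamma\vdash^\pi\nu x\,D$ if $\Gamma,x:A\vdash^\pi D$ for some $A$; $\Gamma\vdash^\pi\nu x\,(\{!\}x(y_1,\ldots,y_n).D'\mid D)$ if $\Gamma,y_1:A_1,\ldots,y_n:A_n\vdash^\pi D'$ and $\Gamma,x:\langle A_1,\ldots,A_n\rangle\vdash^\pi D$; $\Gamma\vdash^\pi\overline{x}(y_1,\ldots,y_n)$ if $x:\langle A_1,\ldots,A_n\rangle\in\Gamma$ and $y_i:A_i\in\Gamma$ for all $i$; $\Gamma\vdash^\pi(M_1\mid M_2)$ if $\Gamma\vdash^\pi M_i$ for $i=1,2$. *)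

(* Defs.v *)
(* World: plain MathComp boot (ssrnat, seq).  Typed pi-calculus with
   declarations, de Bruijn representation of names (so processes are
   automatically taken up to alpha-renaming of bound names). *)
From mathcomp Require Import ssreflect ssrfun ssrbool eqtype ssrnat seq.

Set Implicit Arguments.
Unset Strict Implicit.
Unset Printing Implicit Defensive.

(*  terms  M ::= x<y_1,...,y_n> (n >= 1)  |  M | M                      *)
(*  Out x y ys  is  \overline{x}(y :: ys).                              *)
Inductive tm : Type :=
| Out (x : nat) (y : nat) (ys : seq nat)
| Par (M1 M2 : tm).

(*  declarations
      DNew D              = nu x D                 (x = index 0 in D)
      DDef r n B D        = nu x ({!}x(y_1,...,y_{n+1}).B | D)
                            (replicated iff r = true);
                            x = index 0 in D;
                            in the body B, y_i = index (i-1) and index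
                            n+1+k denotes the name k of the scope outside
                            the nu x (x itself is not in scope in B).                                           *)
Inductive decl : Type :=
| DNew (D : decl)
| DDef (rep : bool) (n : nat) (B : decl) (D : decl)
| DTm (M : tm).

(* Types  A ::= <1> | <A_1,...,A_n> (n >= 1).  TCh A As = <A :: As>. *)
Inductive ty : Type :=
| TOne
| TCh (A : ty) (As : seq ty).

Definition up (f : nat -> nat) (i : nat) : nat :=
  if i is k.+1 then (f k).+1 else 0.

Definition upn (k : nat) (f : nat -> nat) : nat -> nat := iter k up f.

Fixpoint ren_tm (f : nat -> nat) (M : tm) : tm :=
  match M with
  | Out x y ys => Out (f x) (f y) (map f ys)
  | Par M1 M2 => Par (ren_tm f M1) (ren_tm f M2)
  end.

Fixpoint ren_decl (f : nat -> nat) (D : decl) : decl :=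
  match D with
  | DNew D' => DNew (ren_decl (up f) D')
  | DDef r n B D' => DDef r n (ren_decl (upn n.+1 f) B) (ren_decl (up f) D')
  | DTm M => DTm (ren_tm f M)
  end.

(* Placing a declaration in a term position: its binders/definitions    *)
(* are moved outward in front (the sibling term is shifted, i.e.        *)
(* renamed apart).                                                      *)
Fixpoint par_l (D : decl) (M : tm) : decl :=
  match D with
  | DNew D' => DNew (par_l D' (ren_tm succn M))
  | DDef r n B D' => DDef r n B (par_l D' (ren_tm succn M))
  | DTm M' => DTm (Par M' M)
  end.

Fixpoint par_r (M : tm) (D : decl) : decl :=
  match D with
  | DNew D' => DNew (par_r (ren_tm succn M) D')
  | DDef r n B D' => DDef r n B (par_r (ren_tm succn M) D')
  | DTm M' => DTm (Par M M')
  end.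

(* Evaluation contexts
     E ::= [] | E[nu x []] | E[nu x ({!}x(y+).D | [])] | E[[] | M] | E[M | []]
   represented as the list of layers from the outermost to the
   innermost one.  Each layer's data lives in the scope of that layer. *)
Inductive layer : Type :=
| LNew
| LDef (rep : bool) (n : nat) (B : decl)
| LParL (M : tm)
| LParR (M : tm).

Definition ectx := seq layer.

Definition fill_layer (l : layer) (D : decl) : decl :=
  match l with
  | LNew => DNew D
  | LDef r n B => DDef r n B D
  | LParL M => par_l D M
  | LParR M => par_r M D
  end.

Fixpoint plug (E : ectx) (D : decl) : decl :=
  match E with
  | [::] => D
  | l :: E' => fill_layer l (plug E' D)
  end.

Fixpoint depth (E : ectx) : nat :=
  match E with
  | [::] => 0
  | LNew :: E' => (depth E').+1
  | LDef _ _ _ :: E' => (depth E').+1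
  | _ :: E' => depth E'
  end.

Inductive binder : Type :=
| BNew
| BDef (rep : bool) (n : nat) (B : decl).

Definition bind (b : binder) (D : decl) : decl :=
  match b with
  | BNew => DNew D
  | BDef r n B => DDef r n B D
  end.

Definition ren_binder (f : nat -> nat) (b : binder) : binder :=
  match b with
  | BNew => BNew
  | BDef r n B => BDef r n (ren_decl (upn n.+1 f) B)
  end.

Definition swap01 (i : nat) : nat :=
  match i with 0 => 1 | 1 => 0 | _ => i end.

Inductive scong : decl -> decl -> Prop :=
| SC_refl D : scong D D
| SC_sym D1 D2 : scong D1 D2 -> scong D2 D1
| SC_trans D1 D2 D3 : scong D1 D2 -> scong D2 D3 -> scong D1 D3
(* nu x1 (b1 | nu x2 (b2 | D)) == nu x2 (b2 | nu x1 (b1 | D)), where the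
   definition body of b2 does not mention x1 (it is the shift of a body
   in the outer scope), the body of b1 gets shifted under x2, and x1,x2
   are exchanged in D *)
| SC_swap b1 b2 D :
    scong (bind b1 (bind (ren_binder succn b2) D))
          (bind b2 (bind (ren_binder succn b1) (ren_decl swap01 D)))
(* nu x ({{!}x(y+).D' |} D) == D   if x not free in D *)
| SC_gc b D : scong (bind b (ren_decl succn D)) D
| SC_new D1 D2 : scong D1 D2 -> scong (DNew D1) (DNew D2)
| SC_defB r n B1 B2 D : scong B1 B2 -> scong (DDef r n B1 D) (DDef r n B2 D)
| SC_defC r n B D1 D2 : scong D1 D2 -> scong (DDef r n B D1) (DDef r n B D2)
| SC_parl D1 D2 M : scong D1 D2 -> scong (par_l D1 M) (par_l D2 M)
| SC_parr M D1 D2 : scong D1 D2 -> scong (par_r M D1) (par_r M D2).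

(* [z+/y+]B placed at the hole of E', where the defined name x is at    *)
(* index d = depth E'.                                                   *)
Definition inst (n : nat) (B : decl) (d : nat) (zs : seq nat) : decl :=
  ren_decl (fun i => if i < n.+1 then nth 0 zs i else i - n.+1 + d.+1) B.

Inductive step : decl -> decl -> Prop :=
| St_rep E E' n B z zs :
    size zs = n ->
    step (plug E (DDef true n B (plug E' (DTm (Out (depth E') z zs)))))
         (plug E (DDef true n B (plug E' (inst n B (depth E') (z :: zs)))))
| St_lin E E' n B z zs :
    size zs = n ->
    step (plug E (DDef false n B (plug E' (DTm (Out (depth E') z zs)))))
         (plug E (DNew (plug E' (inst n B (depth E') (z :: zs))))).

(* the least relation containing step and closed under == *)
Definition red (D D' : decl) : Prop :=
  exists D1 D2, scong D D1 /\ step D1 D2 /\ scong D2 D'.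

(* Typing.  A typing environment assigns to the free name i the type    *)
(* onth G i (None = not in the domain).                                 *)
Inductive typed_tm : seq ty -> tm -> Prop :=
| T_Out G x z zs A As :
    onth G x = Some (TCh A As) ->
    map (onth G) (z :: zs) = map Some (A :: As) ->
    typed_tm G (Out x z zs)
| T_Par G M1 M2 : typed_tm G M1 -> typed_tm G M2 -> typed_tm G (Par M1 M2).

Inductive typed : seq ty -> decl -> Prop :=
| T_New G A D : typed (A :: G) D -> typed G (DNew D)
| T_Def G r n A As B D :
    size As = n ->
    typed (A :: As ++ G) B ->
    typed (TCh A As :: G) D ->
    typed G (DDef r n B D)
| T_Tm G M : typed_tm G M -> typed G (DTm M).

Definition diverges (D : decl) : Prop :=
  exists f : nat -> decl, f 0 = D /\ forall k, red (f k) (f k.+1).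

(* Main.v *)
(* Interpret a channel type <A_1,...,A_n> as the set of functions from semantic
   argument tuples to nat, the price of a call.  Under an environment giving
   each name such a price, a process costs the sum of the prices of its
   outputs, provided every definition's price strictly exceeds the cost of its
   body on all arguments.  Costs are invariant under structural congruence, and
   a reduction replaces an output by the body it triggers, so the cost strictly
   drops.  Typing lets us choose prices bottom-up (bodies before their scope),
   hence every typed process has a cost and cannot reduce forever. *)
Require Import Defs.
From mathcomp Require Import ssreflect ssrfun ssrbool eqtype ssrnat seq.
From Stdlib Require Import FunctionalExtensionality ClassicalEpsilon Eqdep.

Set Implicit Arguments.
Unset Strict Implicit.
Unset Printing Implicit Defensive.

Fixpoint sem_tuple (F : ty -> Type) (Ts : seq ty) : Type :=
  match Ts with [::] => unit | T :: Ts' => (F T * sem_tuple F Ts')%type end.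

Fixpoint sem (T : ty) : Type :=
  match T with
  | TOne => unit
  | TCh A As => (sem A * sem_tuple sem As)%type -> nat
  end.

Definition dyn := {T : ty & sem T}.

(* [None] interprets a name carrying no usable price, e.g. a dead definition. *)
Definition env := nat -> option dyn.

Fixpoint tuple_vals (Ts : seq ty) : sem_tuple sem Ts -> seq (option dyn) :=
  match Ts return sem_tuple sem Ts -> seq (option dyn) with
  | [::] => fun _ => [::]
  | T :: Ts' => fun p => Some (existT sem T p.1) :: tuple_vals p.2
  end.

Definition scons (o : option dyn) (r : env) : env :=
  fun i => if i is k.+1 then r k else o.

Definition cat_env (s : seq (option dyn)) (r : env) : env :=
  fun i => if i < size s then nth None s i else r (i - size s).

Definition sem_default (T : ty) : sem T :=
  match T with TOne => tt | TCh _ _ => fun _ => 0 end.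

Lemma size_tuple_vals Ts (p : sem_tuple sem Ts) : size (tuple_vals p) = size Ts.
Proof. by elim: Ts p => [|T Ts IH] //= [x p] /=; rewrite IH. Qed.

Inductive tm_cost : env -> tm -> nat -> Prop :=
| TC_Out r x z zs A As (f : sem (TCh A As)) (a : sem_tuple sem (A :: As)) :
    r x = Some (existT sem (TCh A As) f) ->
    map r (z :: zs) = tuple_vals a ->
    tm_cost r (Out x z zs) (f a)
| TC_Par r M1 M2 k1 k2 :
    tm_cost r M1 k1 -> tm_cost r M2 k2 -> tm_cost r (Par M1 M2) (k1 + k2).

Inductive decl_cost : env -> decl -> nat -> Prop :=
| DC_New r o D k : decl_cost (scons o r) D k -> decl_cost r (DNew D) k
| DC_Def r rp n A As (f : sem (TCh A As)) B D k :
    size As = n ->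
    (forall a : sem_tuple sem (A :: As),
        exists2 c, decl_cost (cat_env (tuple_vals a) r) B c & c < f a) ->
    decl_cost (scons (Some (existT sem (TCh A As) f)) r) D k ->
    decl_cost r (DDef rp n B D) k
| DC_Dead r rp n B D k : decl_cost (scons None r) D k -> decl_cost r (DDef rp n B D) k
| DC_Tm r M k : tm_cost r M k -> decl_cost r (DTm M) k.

Definition prices_body (r : env) (n : nat) (B : decl) (o : option dyn) : Prop :=
  o = None \/
  exists A As (f : sem (TCh A As)), o = Some (existT sem (TCh A As) f) /\
    size As = n /\
    forall a : sem_tuple sem (A :: As),
      exists2 c, decl_cost (cat_env (tuple_vals a) r) B c & c < f a.

Lemma tm_cost_OutE r x z zs k :
  tm_cost r (Out x z zs) k <->
  exists A As (f : sem (TCh A As)) (a : sem_tuple sem (A :: As)),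
    [/\ r x = Some (existT sem (TCh A As) f), map r (z :: zs) = tuple_vals a & k = f a].
Proof.
split; first by move=> h; inversion h; subst; do 4 eexists; split; eauto.
by case=> A [As [f [a [hx ha ->]]]]; apply: TC_Out ha.
Qed.

Lemma tm_cost_ParE r M1 M2 k :
  tm_cost r (Par M1 M2) k <->
  exists k1 k2, [/\ tm_cost r M1 k1, tm_cost r M2 k2 & k = k1 + k2].
Proof.
split; first by move=> h; inversion h; subst; do 2 eexists; split; eauto.
by case=> k1 [k2 [h1 h2 ->]]; apply: TC_Par.
Qed.

Lemma tm_cost_ParC r M1 M2 k : tm_cost r (Par M1 M2) k <-> tm_cost r (Par M2 M1) k.
Proof.
by rewrite !tm_cost_ParE; split=> -[k1 [k2 [h1 h2 ->]]]; exists k2, k1; rewrite addnC.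
Qed.

Lemma decl_cost_NewE r D k : decl_cost r (DNew D) k <-> exists o, decl_cost (scons o r) D k.
Proof.
split; first by move=> h; inversion h; subst; eauto.
by case=> o h; apply: DC_New h.
Qed.

Lemma decl_cost_DefE r rp n B D k :
  decl_cost r (DDef rp n B D) k <->
  exists o, prices_body r n B o /\ decl_cost (scons o r) D k.
Proof.
split.
  move=> h; inversion h; subst; last by exists None; split=> //; left.
  by exists (Some (existT sem (TCh A As) f)); split=> //; right; exists A, As, f.
case=> o [[->|[A [As [f [-> [hs hB]]]]]] h]; first exact: DC_Dead.
exact: DC_Def h.
Qed.

Lemma decl_cost_TmE r M k : decl_cost r (DTm M) k <-> tm_cost r M k.
Proof. by split=> h; [inversion h|constructor]. Qed.

Lemma prices_body_ext n B1 B2 :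
  (forall r k, decl_cost r B1 k <-> decl_cost r B2 k) ->
  forall r o, prices_body r n B1 o <-> prices_body r n B2 o.
Proof.
move=> eqB r o; split=> -[->|[A [As [f [-> [hs hB]]]]]]; [by left| |by left|];
  right; exists A, As, f; do 2 split=> //; move=> a;
  by case: (hB a) => c hc lt; exists c; rewrite ?eqB in hc *.
Qed.

Lemma upnE k f i : upn k f i = if i < k then i else f (i - k) + k.
Proof.
elim: k i => [|k IH] i; first by rewrite /= subn0 addn0.
case: i => [|i] //=.
by rewrite /up -/(upn k f) IH ltnS; case: ifP => // _; rewrite subSS addnS.
Qed.

Lemma cat_env_upn s r f :
  (fun i => cat_env s r (upn (size s) f i)) = cat_env s (fun i => r (f i)).
Proof.
apply: functional_extensionality => i; rewrite upnE /cat_env.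
case: (ltnP i (size s)) => h; first by rewrite h.
by rewrite ltnNge leq_addl /= addnK.
Qed.

Lemma scons_up o r f : (fun i => scons o r (up f i)) = scons o (fun i => r (f i)).
Proof. by apply: functional_extensionality => -[|i]. Qed.

Lemma tm_cost_ren f M r k : tm_cost r (ren_tm f M) k <-> tm_cost (fun i => r (f i)) M k.
Proof.
elim: M r k => [x z zs|M1 IH1 M2 IH2] r k /=.
  have e : map r (map f (z :: zs)) = map (fun i => r (f i)) (z :: zs) by rewrite -map_comp.
  by rewrite !tm_cost_OutE -e.
by rewrite !tm_cost_ParE; split=> -[k1 [k2 [h1 h2 ->]]]; exists k1, k2;
  (split; [apply/IH1|apply/IH2|]).
Qed.

Lemma prices_body_ren n B :
  (forall f r k, decl_cost r (ren_decl f B) k <-> decl_cost (fun i => r (f i)) B k) ->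
  forall f r o,
    prices_body r n (ren_decl (upn n.+1 f) B) o <-> prices_body (fun i => r (f i)) n B o.
Proof.
move=> IH f r o; split=> -[->|[A [As [g [-> [hs hB]]]]]]; [by left| |by left|];
  right; exists A, As, g; do 2 split=> //; move=> a; case: (hB a) => c hc lt;
  exists c => //; have e : n.+1 = size (tuple_vals a) by rewrite size_tuple_vals /= hs.
  by move: hc; rewrite IH e cat_env_upn.
by rewrite IH e cat_env_upn.
Qed.

Lemma decl_cost_ren D f r k :
  decl_cost r (ren_decl f D) k <-> decl_cost (fun i => r (f i)) D k.
Proof.
elim: D f r k => [D IH|rp n B IHB D IH|M] f r k /=.
- by rewrite !decl_cost_NewE; split=> -[o h]; exists o; rewrite ?IH scons_up in h *.
- rewrite !decl_cost_DefE; split=> -[o [h1 h2]]; exists o.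
    by move: h1 h2; rewrite prices_body_ren // IH scons_up.
  by move: h1 h2; rewrite -prices_body_ren // IH scons_up.
- by rewrite !decl_cost_TmE tm_cost_ren.
Qed.

Lemma tm_cost_shift o r M k : tm_cost (scons o r) (ren_tm succn M) k <-> tm_cost r M k.
Proof. by rewrite tm_cost_ren. Qed.

Section ParCost.

Variable par : decl -> tm -> decl.
Hypothesis par_New : forall D M, par (DNew D) M = DNew (par D (ren_tm succn M)).
Hypothesis par_Def :
  forall rp n B D M, par (DDef rp n B D) M = DDef rp n B (par D (ren_tm succn M)).
Hypothesis par_Tm :
  forall r M' M k, decl_cost r (par (DTm M') M) k <-> tm_cost r (Par M' M) k.

Lemma decl_cost_par D r M k :
  decl_cost r (par D M) k <->
  exists k1 k2, [/\ decl_cost r D k1, tm_cost r M k2 & k = k1 + k2].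
Proof.
elim: D r M k => [D IH|rp n B _ D IH|M'] r M k.
- rewrite par_New decl_cost_NewE; split.
    case=> o /IH [k1 [k2 [h1 /tm_cost_shift h2 ->]]].
    by exists k1, k2; split=> //; apply/decl_cost_NewE; exists o.
  case=> k1 [k2 [/decl_cost_NewE [o h1] h2 ->]]; exists o; apply/IH.
  by exists k1, k2; split=> //; apply/tm_cost_shift.
- rewrite par_Def decl_cost_DefE; split.
    case=> o [hB /IH [k1 [k2 [h1 /tm_cost_shift h2 ->]]]].
    by exists k1, k2; split=> //; apply/decl_cost_DefE; exists o.
  case=> k1 [k2 [/decl_cost_DefE [o [hB h1]] h2 ->]]; exists o; split=> //; apply/IH.
  by exists k1, k2; split=> //; apply/tm_cost_shift.
- rewrite par_Tm tm_cost_ParE; split=> -[k1 [k2 [h1 h2 ->]]]; exists k1, k2;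
  by split=> //; apply/decl_cost_TmE.
Qed.

End ParCost.

Lemma decl_cost_par_l D r M k :
  decl_cost r (par_l D M) k <->
  exists k1 k2, [/\ decl_cost r D k1, tm_cost r M k2 & k = k1 + k2].
Proof. by apply: decl_cost_par => // r' M' M'' k'; rewrite decl_cost_TmE. Qed.

Lemma decl_cost_par_r D r M k :
  decl_cost r (par_r M D) k <->
  exists k1 k2, [/\ decl_cost r D k1, tm_cost r M k2 & k = k1 + k2].
Proof.
by apply: (decl_cost_par (par := fun D M => par_r M D)) => // r' M' M'' k';
  rewrite decl_cost_TmE tm_cost_ParC.
Qed.

(* [ctx_cost r E r' k]: the layers of [E] cost [k] under [r], and [r'] is the
   environment reached at the hole. *)
Inductive ctx_cost : env -> ectx -> env -> nat -> Prop :=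
| CC_nil r : ctx_cost r [::] r 0
| CC_New r o E r' k : ctx_cost (scons o r) E r' k -> ctx_cost r (LNew :: E) r' k
| CC_Def r rp n B o E r' k :
    prices_body r n B o -> ctx_cost (scons o r) E r' k ->
    ctx_cost r (LDef rp n B :: E) r' k
| CC_ParL r M E r' k1 k2 :
    tm_cost r M k2 -> ctx_cost r E r' k1 -> ctx_cost r (LParL M :: E) r' (k1 + k2)
| CC_ParR r M E r' k1 k2 :
    tm_cost r M k2 -> ctx_cost r E r' k1 -> ctx_cost r (LParR M :: E) r' (k1 + k2).

Lemma decl_cost_plug E r X k :
  decl_cost r (plug E X) k <->
  exists r' k1 k2, [/\ ctx_cost r E r' k1, decl_cost r' X k2 & k = k1 + k2].
Proof.
elim: E r X k => [|l E IH] r X k /=.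
  split; first by exists r, 0, k; split=> //; constructor.
  by case=> r' [k1 [k2 [hE h ->]]]; inversion hE; subst.
case: l => [|rp n B|M|M] /=.
- rewrite decl_cost_NewE; split.
    by case=> o /IH [r' [k1 [k2 [hE h ->]]]]; exists r', k1, k2; split=> //; apply: CC_New hE.
  case=> r' [k1 [k2 [hE h ->]]]; inversion hE; subst.
  by exists o; apply/IH; exists r', k1, k2.
- rewrite decl_cost_DefE; split.
    case=> o [hB /IH [r' [k1 [k2 [hE h ->]]]]].
    by exists r', k1, k2; split=> //; apply: CC_Def hE.
  case=> r' [k1 [k2 [hE h ->]]]; inversion hE; subst.
  by exists o; split=> //; apply/IH; exists r', k1, k2.
- rewrite decl_cost_par_l; split.
    case=> ka [kb [/IH [r' [k1 [k2 [hE h ->]]]] hM ->]].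
    by exists r', (k1 + kb), k2; split; [constructor|by []|rewrite addnAC].
  case=> r' [k1 [k2 [hE h ->]]]; inversion hE; subst.
  by exists (k0 + k2), k3; split=> //; [apply/IH; exists r', k0, k2|rewrite addnAC].
- rewrite decl_cost_par_r; split.
    case=> ka [kb [/IH [r' [k1 [k2 [hE h ->]]]] hM ->]].
    by exists r', (k1 + kb), k2; split; [constructor|by []|rewrite addnAC].
  case=> r' [k1 [k2 [hE h ->]]]; inversion hE; subst.
  by exists (k0 + k2), k3; split=> //; [apply/IH; exists r', k0, k2|rewrite addnAC].
Qed.

Lemma ctx_cost_depth r E r' k : ctx_cost r E r' k -> forall i, r' (depth E + i) = r i.
Proof.
elim=> {r E r' k} //= => [r o E r' k _ IH|r rp n B o E r' k _ _ IH] i;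
  by rewrite addSnnS IH.
Qed.

Definition prices_binder (r : env) (b : binder) (o : option dyn) : Prop :=
  if b is BDef _ n B then prices_body r n B o else True.

Lemma decl_cost_bind r b D k :
  decl_cost r (bind b D) k <-> exists o, prices_binder r b o /\ decl_cost (scons o r) D k.
Proof.
case: b => [|rp n B] /=; last exact: decl_cost_DefE.
by rewrite decl_cost_NewE; split=> -[o h]; exists o => //; case: h.
Qed.

Lemma prices_binder_shift r o' b o :
  prices_binder (scons o' r) (ren_binder succn b) o <-> prices_binder r b o.
Proof. by case: b => [|rp n B] //=; rewrite prices_body_ren // => *; apply: decl_cost_ren. Qed.

Lemma scons_swap01 o1 o2 r :
  (fun i => scons o1 (scons o2 r) (swap01 i)) = scons o2 (scons o1 r).
Proof. by apply: functional_extensionality => -[|[|i]]. Qed.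

Lemma decl_cost_swap b1 b2 D r k :
  decl_cost r (bind b1 (bind (ren_binder succn b2) D)) k <->
  decl_cost r (bind b2 (bind (ren_binder succn b1) (ren_decl swap01 D))) k.
Proof.
rewrite !decl_cost_bind; split.
  case=> o1 [h1 /decl_cost_bind [o2 [/prices_binder_shift h2 h]]].
  exists o2; split=> //; apply/decl_cost_bind; exists o1.
  by rewrite prices_binder_shift decl_cost_ren scons_swap01.
case=> o2 [h2 /decl_cost_bind [o1 [/prices_binder_shift h1]]].
rewrite decl_cost_ren scons_swap01 => h.
by exists o1; split=> //; apply/decl_cost_bind; exists o2; rewrite prices_binder_shift.
Qed.

Lemma decl_cost_scong D1 D2 r k : scong D1 D2 -> decl_cost r D1 k <-> decl_cost r D2 k.
Proof.
move=> hs; elim: hs r k => {D1 D2}.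
- by [].
- by move=> D1 D2 _ IH r k; rewrite IH.
- by move=> D1 D2 D3 _ IH1 _ IH2 r k; rewrite IH1 IH2.
- by move=> *; apply: decl_cost_swap.
- move=> b D r k; rewrite decl_cost_bind; split; first by case=> o [_]; rewrite decl_cost_ren.
  by exists None; split; [case: b => //=; left|rewrite decl_cost_ren].
- by move=> D1 D2 _ IH r k; rewrite !decl_cost_NewE; split=> -[o h]; exists o; rewrite ?IH in h *.
- move=> rp n B1 B2 D _ IH r k; rewrite !decl_cost_DefE.
  by split=> -[o [h1 h2]]; exists o; split=> //; apply/(prices_body_ext n IH r o).
- by move=> rp n B D1 D2 _ IH r k; rewrite !decl_cost_DefE;
    split=> -[o [h1 h2]]; exists o; rewrite ?IH in h2 *.
- by move=> D1 D2 M _ IH r k; rewrite !decl_cost_par_l;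
    split=> -[k1 [k2 [h1 h2 ->]]]; exists k1, k2; split=> //; apply/IH.
- by move=> M D1 D2 _ IH r k; rewrite !decl_cost_par_r;
    split=> -[k1 [k2 [h1 h2 ->]]]; exists k1, k2; split=> //; apply/IH.
Qed.

Lemma inst_ren_env r1 o E r2 k z zs Ts (a : sem_tuple sem Ts) :
  ctx_cost (scons o r1) E r2 k -> map r2 (z :: zs) = tuple_vals a ->
  (fun i => r2 (if i < (size zs).+1 then nth 0 (z :: zs) i
                else i - (size zs).+1 + (depth E).+1))
  = cat_env (tuple_vals a) r1.
Proof.
move=> hE ha; apply: functional_extensionality => i.
have sa : size (tuple_vals a) = (size zs).+1 by rewrite -ha size_map.
rewrite /cat_env sa; case: ifP => hi; first by rewrite -ha (nth_map 0).
by rewrite addnS -addSn addnC (ctx_cost_depth hE).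
Qed.

Lemma decl_cost_fire r1 o E r2 k3 n B z zs k :
  size zs = n -> prices_body r1 n B o -> ctx_cost (scons o r1) E r2 k3 ->
  tm_cost r2 (Out (depth E) z zs) k ->
  exists2 c, decl_cost r2 (inst n B (depth E) (z :: zs)) c & c < k.
Proof.
move=> <- hB hE /tm_cost_OutE [A [As [f [a [hx ha ->]]]]].
have ho : r2 (depth E) = o by rewrite -[depth E]addn0 (ctx_cost_depth hE).
case: hB => [eo|[A' [As' [f' [eo [_ hB]]]]]]; rewrite -ho hx in eo => //.
move/Some_inj: eo => eo; case: (f_equal (@projT1 _ _) eo) => eA eAs; subst A' As'.
rewrite -(inj_pair2 _ _ _ _ _ eo) in hB; case: (hB a) => c hc lt.
by exists c => //; rewrite /inst decl_cost_ren (inst_ren_env hE ha).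
Qed.

Lemma step_decreases_cost D1 D2 r k :
  step D1 D2 -> decl_cost r D1 k -> exists2 k', decl_cost r D2 k' & k' < k.
Proof.
case=> E E' n B z zs hzs; rewrite !decl_cost_plug => -[r1 [k1 [k2 [hE hD ->]]]];
  move: hD; rewrite decl_cost_DefE => -[o [hB]];
  rewrite decl_cost_plug => -[r2 [k3 [k4 [hE' /decl_cost_TmE hM ->]]]];
  have [c hc lt] := decl_cost_fire hzs hB hE' hM;
  exists (k1 + (k3 + c)); rewrite ?ltn_add2l //;
  apply/decl_cost_plug; exists r1, k1, (k3 + c); split=> //.
  by apply/decl_cost_DefE; exists o; split=> //; apply/decl_cost_plug; exists r2, k3, c.
(* The consumed linear definition becomes a restriction that keeps its price. *)
by apply/decl_cost_NewE; exists o; apply/decl_cost_plug; exists r2, k3, c.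
Qed.

Lemma red_decreases_cost r D1 D2 k :
  red D1 D2 -> decl_cost r D1 k -> exists2 k', decl_cost r D2 k' & k' < k.
Proof.
case=> D1' [D2' [s1 [st s2]]] /(decl_cost_scong _ _ s1) h.
have [k' h' lt] := step_decreases_cost st h.
by exists k' => //; apply/(decl_cost_scong _ _ s2).
Qed.

Lemma no_infinite_descent (T : Type) (R : T -> T -> Prop) (cost : T -> nat -> Prop) :
  (forall x y k, R x y -> cost x k -> exists2 k', cost y k' & k' < k) ->
  forall (f : nat -> T) k, cost (f 0) k -> ~ (forall m, R (f m) (f m.+1)).
Proof.
move=> dec f k; elim/ltn_ind: k f => k IH f hk hf.
have [k' hk' lt] := dec _ _ _ (hf 0) hk.
exact: (IH k' lt (fun m => f m.+1) hk' (fun m => hf m.+1)).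
Qed.

Definition env_realizes (G : seq ty) (r : env) :=
  forall i T, onth G i = Some T -> exists v, r i = Some (existT sem T v).

Definition default_env (G : seq ty) : env :=
  fun i => if onth G i is Some T then Some (existT sem T (sem_default T)) else None.

Lemma default_env_realizes G : env_realizes G (default_env G).
Proof. by move=> i T hi; exists (sem_default T); rewrite /default_env hi. Qed.

Lemma env_realizes_cons G r T v :
  env_realizes G r -> env_realizes (T :: G) (scons (Some (existT sem T v)) r).
Proof. by move=> hr [|i] U /=; [case=> <-; exists v|apply: hr]. Qed.

Lemma nth_tuple_vals Ts (p : sem_tuple sem Ts) i T :
  onth Ts i = Some T -> exists v, nth None (tuple_vals p) i = Some (existT sem T v).
Proof.
elim: Ts p i => [|U Ts IH] p [|i] //=; last exact: IH.
by case=> <-; exists p.1.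
Qed.

Lemma env_realizes_cat G r Ts (p : sem_tuple sem Ts) :
  env_realizes G r -> env_realizes (Ts ++ G) (cat_env (tuple_vals p) r).
Proof.
move=> hr i T; rewrite onth_cat /cat_env size_tuple_vals.
by case: ifP => _; [apply: nth_tuple_vals|apply: hr].
Qed.

Lemma env_realizes_args G r (l : seq nat) Ts :
  env_realizes G r -> map (onth G) l = map Some Ts ->
  exists p : sem_tuple sem Ts, map r l = tuple_vals p.
Proof.
move=> hr; elim: l Ts => [|x l IH] [|T Ts] //= [/hr [v hv] /IH [p hp]].
by exists (v, p); rewrite /= hv hp.
Qed.

Lemma typed_tm_cost G M r : typed_tm G M -> env_realizes G r -> exists k, tm_cost r M k.
Proof.
move=> hM; elim: hM r => {G M} [G x z zs A As hx hargs|G M1 M2 _ IH1 _ IH2] r hr.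
  have [f hf] := hr _ _ hx; have [a ha] := env_realizes_args hr hargs.
  by exists (f a); apply: TC_Out ha.
have [k1 h1] := IH1 r hr; have [k2 h2] := IH2 r hr.
by exists (k1 + k2); apply: TC_Par.
Qed.

(* The price of a definition is chosen as one more than a cost of its body. *)
Lemma typed_decl_cost G D :
  typed G D -> forall r, env_realizes G r -> exists k, decl_cost r D k.
Proof.
elim=> {G D} [G A D _ IH|G rp n A As B D hs _ IHB _ IHD|G M hM] r hr.
- have [k hk] := IH _ (env_realizes_cons (sem_default A) hr).
  by exists k; apply: DC_New hk.
- have [c hc] : exists c : sem_tuple sem (A :: As) -> nat,
      forall a, decl_cost (cat_env (tuple_vals a) r) B (c a).
    apply: (choice (fun a c => decl_cost _ B c)) => a.
    exact/IHB/(@env_realizes_cat G r (A :: As) a hr).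
  have [k hk] := IHD _ (@env_realizes_cons G r (TCh A As) (fun a => (c a).+1) hr).
  by exists k; apply: DC_Def hk => // a; exists (c a).
- by have [k hk] := typed_tm_cost hM hr; exists k; apply: DC_Tm.
Qed.

Theorem corollary3 (G : seq ty) (D : decl) :
  typed G D ->
  ~ (exists f : nat -> decl, f 0 = D /\ forall k, red (f k) (f k.+1)).
Proof.
move=> hT [f [f0 hf]].
have [k hk] := typed_decl_cost hT (@default_env_realizes G).
rewrite -f0 in hk.
exact: (no_infinite_descent (@red_decreases_cost (default_env G)) hk hf).
Qed.
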